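(* Let $\mathcal{S} = (X, \leq, N)$ be a filtered neighbourhood system and let $p, q \in \mathcal{L}_0$ be propositional variables. Then: (i) the axiom $(K)$, i.e. $\Box(p \to q) \to (\Box p \to \Box q)$, is valid on $\mathcal{S}$; (ii) the axiom $(T)$, i.e. $\Box p \to p$, is valid on $\mathcal{S}$ if and only if $i_N$ satisfies $(I_1)$: $i_N(a) \subseteq a$ for every $a \in \mu(X)$; (iii) the axiom $(4)$, i.e. $\Box p \to \Box\Box p$, is valid on $\mathcal{S}$ if and only if $i_N$ satisfies $(I_2)$: $i_N(a) \subseteq i_N(i_N(a))$ for every $a \in \mu(X)$.
   Context: Language: $\mathcal{L}_0$ is a countable set of propositional variables; $\mathcal{L}$ is the set of formulas built from $\mathcal{L}_0 \cup \{\bot\}$ with the binary connectives $\lor, \land, \to$ and the unary connective $\Box$. A preordered set $(X, \leq)$ is a set with a reflexive transitive relation. An upset is a subset $U \subseteq X$ such that $x \in U$ and $x \leq y$ imply $y \in U$; $\mu(X)$ is the set of all upsets. $\mu(X)$ is a Heyting algebra under $\cup, \cap, \varnothing, X$ and $a \rhd b = \{x \in X \mid \text{for every } y \in X,\ \text{if } x \leq y \text{ and } y \in a \text{ then } y \in b\}$. A neighbourhood space (also called neighbourhood system) is a triple $\mathcal{S} = (X, \leq, N)$ where $(X,\leq)$ is a preordered set and $N : X \to \mathcal{P}(\mu(X))$, $x \mapsto N_x$, satisfies $N_x \subseteq N_y$ whenever $x \leq y$. For $U \subseteq X$ put $i_N(U) = \{x \in X \mid U \in N_x\}$; $i_N$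 maps $\mu(X)$ into $\mu(X)$. $\mathcal{S}$ is filtered if for every $x \in X$ and $U, V \in \mu(X)$: ($U \in N_x$ and $V \in N_x$) if and only if $U \cap V \in N_x$; equivalently $i_N(U) \cap i_N(V) = i_N(U \cap V)$ for all $U,V \in \mu(X)$. A neighbourhood model for $\mathcal{S}$ is a pair $(\mathcal{S}, v)$ with $v : \mathcal{L}_0 \to \mu(X)$ a valuation. It extends to $V : \mathcal{L} \to \mu(X)$ by $V|_{\mathcal{L}_0} = v$, $V(\bot) = \varnothing$, $V(A \land B) = V(A) \cap V(B)$, $V(A \lor B) = V(A) \cup V(B)$, $V(A \to B) = V(A) \rhd V(B)$, $V(\Box A) = i_N(V(A))$. A formula $A$ is valid on $\mathcal{S}$ if $V(A) = X$ for every neighbourhood model for $\mathcal{S}$. *)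

(* Defs.v *)
From Stdlib Require Export RelationClasses.
From mathcomp Require Export all_boot.
From mathcomp Require Export classical_sets.

Set Implicit Arguments.
Unset Strict Implicit.
Unset Printing Implicit Defensive.

Local Open Scope classical_set_scope.

Inductive formula (L0 : countType) : Type :=
  | Var of L0
  | Bot
  | And of formula L0 & formula L0
  | Or of formula L0 & formula L0
  | Imp of formula L0 & formula L0
  | Box of formula L0.

Arguments Bot {L0}.

Definition upsets (X : Type) (le : X -> X -> Prop) : set (set X) :=
  [set U | forall x y, U x -> le x y -> U y].

(** A map [N : X -> P(mu(X))] is represented by [N : X -> set (set X)] such
    that all the members of each [N x] are upsets. *)
Record neighbourhood_system : Type := NeighbourhoodSystem {
  carrier :> Type;
  le : carrier -> carrier -> Prop;
  le_preorder : PreOrder le;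
  nbh : carrier -> set (set carrier);
  nbh_upset : forall x, nbh x `<=` upsets le;
  nbh_mono : forall x y, le x y -> nbh x `<=` nbh y
}.

Definition mu (S : neighbourhood_system) : set (set S) := upsets (@le S).

Definition i_N (S : neighbourhood_system) (U : set S) : set S :=
  [set x | nbh x U].

Definition rhd (S : neighbourhood_system) (a b : set S) : set S :=
  [set x | forall y, le x y -> a y -> b y].

Definition filtered (S : neighbourhood_system) : Prop :=
  forall (x : S) (U V : set S), mu U -> mu V ->
    (nbh x U /\ nbh x V) <-> nbh x (U `&` V).

Record neighbourhood_model (L0 : countType) (S : neighbourhood_system) : Type :=
  NeighbourhoodModel {
    valuation :> L0 -> set S;
    valuation_upset : forall p, mu (valuation p)
  }.

(** [interp v A] is V(A); it belongs to [mu S] by [interp_upset] below. *)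
Fixpoint interp (L0 : countType) (S : neighbourhood_system)
    (v : neighbourhood_model L0 S) (A : formula L0) : set S :=
  match A with
  | Var p => v p
  | Bot => set0
  | And A B => interp v A `&` interp v B
  | Or A B => interp v A `|` interp v B
  | Imp A B => rhd (interp v A) (interp v B)
  | Box A => i_N (interp v A)
  end.

Definition valid (L0 : countType) (S : neighbourhood_system)
    (A : formula L0) : Prop :=
  forall v : neighbourhood_model L0 S, interp v A = setT.

Definition axiom_K (L0 : countType) (p q : L0) : formula L0 :=
  Imp (Box (Imp (Var p) (Var q))) (Imp (Box (Var p)) (Box (Var q))).

Definition axiom_T (L0 : countType) (p : L0) : formula L0 :=
  Imp (Box (Var p)) (Var p).

Definition axiom_4 (L0 : countType) (p : L0) : formula L0 :=
  Imp (Box (Var p)) (Box (Box (Var p))).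

Lemma i_N_upset (S : neighbourhood_system) (U : set S) : mu (i_N U).
Proof. by move=> x y Ux xy; apply: (nbh_mono xy). Qed.

Lemma rhd_upset (S : neighbourhood_system) (a b : set S) : mu (rhd a b).
Proof.
move=> x y ab xy z yz; apply: ab.
by have [_ tr] := le_preorder S; apply: tr xy yz.
Qed.

Lemma interp_upset (L0 : countType) (S : neighbourhood_system)
  (v : neighbourhood_model L0 S) (A : formula L0) : mu (interp v A).
Proof.
elim: A => [p||A IHA B IHB|A IHA B IHB|A _ B _|A _] /=.
- exact: valuation_upset.
- by [].
- by move=> x y [Ax Bx] xy; split; [apply: IHA Ax xy|apply: IHB Bx xy].
- by move=> x y [Ax|Bx] xy; [left; apply: IHA Ax xy|right; apply: IHB Bx xy].
- exact: rhd_upset.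
- exact: i_N_upset.
Qed.

(* Main.v *)
Require Import Defs.
From mathcomp Require Import all_boot.
From mathcomp Require Import classical_sets.

Local Open Scope classical_set_scope.

(** Since [le] is reflexive, an implication is valid exactly when the value of its antecedent is
    always included in that of its consequent ([valid_imp]), so each axiom becomes an inclusion
    between upsets. For (K), filteredness makes [i_N] monotone and compatible with intersections,
    which carries modus ponens through [i_N] ([filtered_i_N_rhd]). For (T) and (4), every upset is
    the value of [p] under some valuation, so validity quantifies over all of [mu S]. *)

Lemma rhd_eq_setT (S : neighbourhood_system) (a b : set S) :
  rhd a b = setT <-> a `<=` b.
Proof.
have [le_refl _] := le_preorder S.
split=> [abT x ax|ab].
  have : rhd a b x by rewrite abT.
  by apply; [exact: le_refl|].
by apply/seteqP; split=> // x _ y _; apply: ab.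
Qed.

Lemma valid_imp (L0 : countType) (S : neighbourhood_system)
    (A B : formula L0) :
  valid S (Imp A B) <->
  forall v : neighbourhood_model L0 S, interp v A `<=` interp v B.
Proof. by split=> AB v; apply/rhd_eq_setT; apply: AB. Qed.

Lemma rhd_setI (S : neighbourhood_system) (a b : set S) :
  rhd a b `&` a `<=` b.
Proof.
by have [le_refl _] := le_preorder S; move=> x [ab ax]; apply: ab (le_refl x) ax.
Qed.

(** If [a] lies in [b] then [a] equals its intersection with [b], and filteredness splits that
    neighbourhood into its two factors. *)
Lemma filtered_i_N_subset (S : neighbourhood_system) (a b : set S) :
  filtered S -> mu a -> mu b -> a `<=` b -> i_N a `<=` i_N b.
Proof.
move=> hS mua mub ab x Na.
have Nab : nbh x (a `&` b) by rewrite (setIidl ab).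
by case/(hS x a b mua mub): Nab.
Qed.

Lemma filtered_i_N_rhd (S : neighbourhood_system) (a b : set S) :
  filtered S -> mu a -> mu b -> i_N (rhd a b) `<=` rhd (i_N a) (i_N b).
Proof.
move=> hS mua mub x Nab y xy Na.
have murhd : mu (rhd a b) by apply: rhd_upset.
have muI : mu (rhd a b `&` a).
  by move=> u w [abu au] uw; split; [exact: murhd abu uw|exact: mua au uw].
(* By monotonicity and modus ponens, it suffices that the intersection of [rhd a b] and [a] is a
   neighbourhood of [y]; the factor [rhd a b] is inherited from [x]. *)
apply: (filtered_i_N_subset _ _ _ hS muI mub (rhd_setI _ _ _)).
by apply/(hS y _ _ murhd mua); split=> //; apply: nbh_mono xy _ Nab.
Qed.

Theorem proposition5p6 (L0 : countType) (S : neighbourhood_system)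
  (hS : filtered S) (p q : L0) :
  valid S (axiom_K p q)
  /\ (valid S (axiom_T p) <->
      (forall a : set S, mu a -> i_N a `<=` a))
  /\ (valid S (axiom_4 p) <->
      (forall a : set S, mu a -> i_N a `<=` i_N (i_N a))).
Proof.
(* Only the value at [p] matters for (T) and (4), so a constant valuation realises any upset
   there. *)
pose const_model (a : set S) (mua : mu a) : neighbourhood_model L0 S :=
  @NeighbourhoodModel L0 S (fun=> a) (fun=> mua).
split.
  by apply/valid_imp => v; apply: filtered_i_N_rhd => //; exact: valuation_upset.
split; split=> [/valid_imp ax a mua|I].
- exact: ax (const_model a mua).
- by apply/valid_imp => v; apply: I; exact: valuation_upset.
- exact: ax (const_model a mua).
- by apply/valid_imp => v; apply: I; exact: valuation_upset.
Qed.
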